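(* For every compact Hausdorff space $X$ there exists an inverse system of finite topological spaces (indexed by a directed set, with continuous bonding maps) whose inverse limit, taken in the category of topological spaces, has the same shape as $X$.
   Context: A finite space is a topological space with finitely many points (no separation axiom is imposed). The inverse limit of an inverse system of spaces $(X_\lambda, p_{\lambda\lambda'},\Lambda)$ is the subspace of $\prod_{\lambda\in\Lambda}X_\lambda$ consisting of all $(x_\lambda)$ with $p_{\lambda\lambda'}(x_{\lambda'})=x_\lambda$ whenever $\lambda\le\lambda'$; it need not be Hausdorff. Shape. For topological spaces $Z,R$, let $[Z,R]$ denote the set of homotopy classes of continuous maps $Z\to R$, and $[h]$ the homotopy class of $h$. A metric ANR is a metrizable space that is an absolute neighborhood retract for the class of metrizable spaces. The shape category (in the sense of Mardešić and Mardešić–Segal, for arbitrary topological spaces) can be described as follows. Its objects are all topological spaces. A shape morphism $X\to Y$ is a natural transformation from the functor $P\mapsto [Y,P]$ to the functor $P\mapsto [X,P]$, where $P$ ranges over the homotopy category of metric ANRs (objects: metric ANRs; morphisms: homotopy classes of continuous maps, acting by post-composition); the composite of shape morphisms $X\to Y$ and $Y\to W$ is obtained by composing the natural transformations $[W,-]\to[Y,-]\to[X,-]$. A continuous map $f:X\to Y$ induces the shape morphism given by $[h]\mapsto[h\circ f]$. Two spaces have the same shape if they are isomorphic in the shape category. *)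

(* Defs.v *)
From HB Require Import structures.
From mathcomp Require Import all_boot all_order all_algebra generic_quotient.
From mathcomp Require Import all_classical reals topology normedtype.
From mathcomp Require Import homotopy.

Set Implicit Arguments.
Unset Strict Implicit.
Unset Printing Implicit Defensive.

Import Order.TTheory GRing.Theory Num.Theory.
Import numFieldTopology.Exports numFieldNormedType.Exports.

Local Open Scope classical_set_scope.
Local Open Scope ring_scope.
Local Open Scope quotient_scope.

Definition homeomorphic (X Y : topologicalType) : Prop :=
  exists (f : X -> Y) (g : Y -> X),
    [/\ cancel f g, cancel g f, continuous f & continuous g].

Lemma continuousC (X Y Z : topologicalType) (f : X -> Y) (g : Y -> Z) :
  continuous f -> continuous g -> continuous (fun x => g (f x)).
Proof. by move=> cf cg x; apply: (@continuous_comp _ _ _ f g); [exact: cf|exact: cg]. Qed.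

Lemma continuous_fst (X Y : topologicalType) : continuous (@fst X Y).
Proof. by move=> p; exact: cvg_fst. Qed.

Lemma continuous_snd (X Y : topologicalType) : continuous (@snd X Y).
Proof. by move=> p; exact: cvg_snd. Qed.

Lemma continuous_pair (X Y Z : topologicalType) (f : X -> Y) (g : X -> Z) :
  continuous f -> continuous g -> continuous (fun x => (f x, g x)).
Proof.
move=> cf cg x.
exact: (@cvg_pair _ _ _ (nbhs x) (nbhs (f x)) (nbhs (g x)) _ _ _ f g (cf x) (cg x)).
Qed.

Lemma continuous_set_val (X : topologicalType) (A : set X) :
  continuous (set_val : set_type A -> X).
Proof. exact: initial_continuous. Qed.

Record inverse_system (d : Order.disp_t) (I : preorderType d) := InverseSystem {
  term :> I -> topologicalType;
  bond : forall i j : I, (i <= j)%O -> term j -> term i;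
  bond_continuous : forall i j (ij : (i <= j)%O), continuous (bond ij);
  bond_id : forall i (ii : (i <= i)%O) x, bond ii x = x;
  bond_comp : forall i j k (ij : (i <= j)%O) (jk : (j <= k)%O) (ik : (i <= k)%O) x,
    bond ij (bond jk x) = bond ik x }.

Arguments bond {d I} S {i j} ij x : rename.

Definition directed (d : Order.disp_t) (I : preorderType d) : Prop :=
  (exists i : I, True) /\
  forall i j : I, exists k : I, (i <= k)%O /\ (j <= k)%O.

Definition limit_set (d : Order.disp_t) (I : preorderType d)
    (S : inverse_system I) : set (prod_topology (fun i : I => S i)) :=
  [set x | forall (i j : I) (ij : (i <= j)%O), bond S ij (x j) = x i].

Arguments limit_set {d I} S _.

Definition inverse_limit (d : Order.disp_t) (I : preorderType d)
    (S : inverse_system I) : topologicalType := set_type (limit_set S).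

Section Homotopy.
Context (R : realType).

Definition unit_interval : topologicalType := set_type [set` `[0 : R, 1]].

Lemma unit0_subproof : (0 : R) \in [set` `[0 : R, 1]].
Proof. by rewrite inE /= in_itv /= lexx ler01. Qed.

Lemma unit1_subproof : (1 : R) \in [set` `[0 : R, 1]].
Proof. by rewrite inE /= in_itv /= lexx ler01. Qed.

Definition unit0 : unit_interval := exist (fun t : R => t \in [set` `[0 : R, 1]]) _ unit0_subproof.
Definition unit1 : unit_interval := exist (fun t : R => t \in [set` `[0 : R, 1]]) _ unit1_subproof.

Definition homotopic (X Y : topologicalType) (f g : continuousType X Y) : Prop :=
  exists H : X * unit_interval -> Y,
    [/\ continuous H, forall x, H (x, unit0) = f x
      & forall x, H (x, unit1) = g x].

Lemma clamp_subproof (t : R) : Num.max 0 (Num.min 1 t) \in [set` `[0 : R, 1]].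
Proof.
by rewrite inE /= in_itv /= le_max lexx /= ge_max ler01 ge_min lexx.
Qed.

Definition clamp (t : R) : unit_interval := exist (fun t : R => t \in [set` `[0 : R, 1]]) _ (clamp_subproof t).

Lemma clamp0 t : t <= 0 -> clamp t = unit0.
Proof.
move=> t0; apply: val_inj => /=; rewrite min_r ?max_l //.
exact: le_trans t0 ler01.
Qed.

Lemma clamp1 t : 1 <= t -> clamp t = unit1.
Proof. by move=> t1; apply: val_inj => /=; rewrite min_l ?max_r. Qed.

Lemma clamp_continuous : continuous clamp.
Proof.
apply/continuousP => _ [B oB <-].
have -> : clamp @^-1` (set_val @^-1` B) = (fun t => Num.max 0 (Num.min 1 t)) @^-1` B.
  by apply/seteqP; split=> t /=.
move: B oB; apply/continuousP => t.
apply: (@continuous_max R R (cst 0) (fun t => Num.min 1 t)); first exact: cvg_cst.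
by apply: (@continuous_min R R (cst 1) id); [exact: cvg_cst|exact: cvg_id].
Qed.

Lemma continuous_reparam (X Y : topologicalType) (H : X * unit_interval -> Y)
    (u : R -> R) : continuous H -> continuous u ->
  continuous (fun p : X * unit_interval => H (p.1, clamp (u (set_val p.2)))).
Proof.
move=> cH cu; apply: (@continuousC _ _ _
  (fun p : X * unit_interval => (p.1, clamp (u (set_val p.2)))) H) => //.
apply: continuous_pair; first exact: continuous_fst.
apply: (@continuousC _ _ _ snd (fun s : unit_interval => clamp (u (set_val s)))).
  exact: continuous_snd.
apply: (@continuousC _ _ _ (fun s : unit_interval => u (set_val s)) clamp);
  last exact: clamp_continuous.
by apply: (@continuousC _ _ _ (set_val : unit_interval -> R) u) => //;
  exact: continuous_set_val.
Qed.

Lemma homotopic_refl (X Y : topologicalType) (f : continuousType X Y) :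
  homotopic f f.
Proof.
exists (fun p => f p.1); split => //.
by apply: (@continuousC _ _ _ fst f); [exact: continuous_fst | exact: cts_fun].
Qed.

Lemma homotopic_sym (X Y : topologicalType) (f g : continuousType X Y) :
  homotopic f g -> homotopic g f.
Proof.
move=> [H [cH H0 H1]].
exists (fun p => H (p.1, clamp (1 - set_val p.2))); split.
- apply: (@continuous_reparam _ _ H (fun t => 1 - t)) => // t.
  by apply: cvgB; [exact: cvg_cst|exact: cvg_id].
- by move=> x /=; rewrite clamp1 // set_valE /= subr0.
- by move=> x /=; rewrite clamp0 // set_valE /= subrr.
Qed.

Lemma homotopic_trans (X Y : topologicalType) (f g h : continuousType X Y) :
  homotopic f g -> homotopic g h -> homotopic f h.
Proof.
move=> [H [cH H0 H1]] [K [cK K0 K1]].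
pose Hl (p : X * unit_interval) := H (p.1, clamp (2 * set_val p.2)).
pose Kr (p : X * unit_interval) := K (p.1, clamp (2 * set_val p.2 - 1)).
have c2 : continuous (fun t : R => 2 * t).
  by move=> t; apply: cvgM; [exact: cvg_cst|exact: cvg_id].
have cHl : continuous Hl by exact: continuous_reparam.
have cKr : continuous Kr.
  apply: (@continuous_reparam _ _ K (fun t => 2 * t - 1)) => // t.
  by apply: cvgB; [exact: c2|exact: cvg_cst].
pose s (p : X * unit_interval) : R := 2 * set_val p.2.
have cs : continuous s.
  apply: (@continuousC _ _ _ (fun p : X * unit_interval => (set_val p.2 : R))
    (fun t => 2 * t)) => //.
  by apply: (@continuousC _ _ _ snd (set_val : unit_interval -> R));
    [exact: continuous_snd | exact: continuous_set_val].
pose A := s @^-1` [set t | t <= 1]; pose B := s @^-1` [set t | 1 <= t].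
have cA : closed A by apply: preimage_closed => //; exact: closed_le.
have cB : closed B by apply: preimage_closed => //; exact: closed_ge.
have agree p : s p = 1 -> Hl p = Kr p.
  move=> sp; rewrite /Hl /Kr -/(s p) sp.
  by rewrite subrr clamp1 // clamp0 // H1 K0.
pose L p := if s p <= 1 then Hl p else Kr p.
have LB p : 1 <= s p -> L p = Kr p.
  rewrite /L; case: ifPn => // sp1 sp2; apply: agree.
  by apply/eqP; rewrite eq_le sp1 sp2.
exists L; split.
- apply/continuous_closedP => W cW.
  have -> : L @^-1` W = (A `&` Hl @^-1` W) `|` (B `&` Kr @^-1` W).
    apply/seteqP; split=> p /=.
      have [sp|/ltW sp] := leP (s p) 1; last by rewrite LB //; right.
      by rewrite {1}/L sp; left.
    by case=> -[sp]; [rewrite /L sp | rewrite LB].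
  by apply: closedU; apply: closedI => //; exact: preimage_closed.
- by move=> x; rewrite /L /s /Hl /= mulr0 ler01 clamp0.
- move=> x; rewrite LB /s /Kr /= mulr1 ?ler1n //.
  by rewrite clamp1 // lerBrDr.
Qed.

Lemma homotopic_comp (X Y Z : topologicalType) (f f' : continuousType Y Z)
    (g g' : continuousType X Y) : homotopic f f' -> homotopic g g' ->
  homotopic (f \o g) (f' \o g').
Proof.
move=> [H [cH H0 H1]] [K [cK K0 K1]]; apply: (@homotopic_trans _ _ _ (f' \o g)).
  exists (fun p => H (g p.1, p.2)); split=> [|x|x] /=; [|exact: H0|exact: H1].
  apply: (@continuousC _ _ _ (fun p : X * unit_interval => (g p.1, p.2)) H) => //.
  apply: continuous_pair; last exact: continuous_snd.
  by apply: (@continuousC _ _ _ fst g); [exact: continuous_fst | exact: cts_fun].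
exists (f' \o K); split=> [|x|x] /=; [|by rewrite K0|by rewrite K1].
by apply: (@continuousC _ _ _ K f') => //; exact: cts_fun.
Qed.

Definition homotopicb (X Y : topologicalType) : rel (continuousType X Y) :=
  fun f g => `[< homotopic f g >].

Lemma homotopicb_refl (X Y : topologicalType) : reflexive (@homotopicb X Y).
Proof. by move=> f; apply/asboolP; exact: homotopic_refl. Qed.

Lemma homotopicb_sym (X Y : topologicalType) : symmetric (@homotopicb X Y).
Proof. by move=> f g; apply/asboolP/asboolP; exact: homotopic_sym. Qed.

Lemma homotopicb_trans (X Y : topologicalType) : transitive (@homotopicb X Y).
Proof.
by move=> g f h /asboolP fg /asboolP gh; apply/asboolP; exact: homotopic_trans gh.
Qed.

Canonical homotopic_equiv (X Y : topologicalType) :=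
  EquivRel (@homotopicb X Y) (@homotopicb_refl X Y) (@homotopicb_sym X Y)
    (@homotopicb_trans X Y).

Definition htpy_class (X Y : topologicalType) : Type :=
  {eq_quot (homotopic_equiv X Y)}.

Definition hclass (X Y : topologicalType) (f : continuousType X Y) :
  htpy_class X Y := \pi_({eq_quot (homotopic_equiv X Y)}) f.

Definition hrepr (X Y : topologicalType) (a : htpy_class X Y) :
  continuousType X Y := repr (a : {eq_quot (homotopic_equiv X Y)}).

Lemma hreprK (X Y : topologicalType) (a : htpy_class X Y) : hclass (hrepr a) = a.
Proof. exact: reprK. Qed.

Lemma hclassP (X Y : topologicalType) (f g : continuousType X Y) :
  hclass f = hclass g <-> homotopic f g.
Proof.
split=> [/eqmodP/asboolP //|fg]; apply/eqmodP; exact/asboolP.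
Qed.

(* Composition in the homotopy category; by [hcompE] it does not depend on the
   representatives. *)
Definition hcomp (X Y Z : topologicalType) (a : htpy_class Y Z)
    (b : htpy_class X Y) : htpy_class X Z :=
  hclass (hrepr a \o hrepr b : continuousType X Z).

Lemma hcompE (X Y Z : topologicalType) (f : continuousType Y Z)
    (g : continuousType X Y) :
  hcomp (hclass f) (hclass g) = hclass (f \o g : continuousType X Z).
Proof. by apply/hclassP/homotopic_comp; apply/hclassP; exact: hreprK. Qed.

Definition metrizable (X : topologicalType) : Prop :=
  exists M : metricType R, homeomorphic X M.

(* The retraction is a map between subtypes rather than a total map continuous
   within U, so that the empty set is a neighborhood retract of any space. *)
Definition neighborhood_retract (Z : topologicalType) (A : set Z) : Prop :=
  exists U : set Z, [/\ open U, A `<=` U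
    & exists2 r : set_type U -> set_type A, continuous r
        & forall u : set_type U, A (set_val u) -> set_val (r u) = set_val u].

Definition is_metric_ANR (P : topologicalType) : Prop :=
  metrizable P /\
  forall Z : topologicalType, metrizable Z ->
  forall A : set Z, closed A -> homeomorphic P (set_type A) ->
  neighborhood_retract A.

Record metric_ANR := MetricANR {
  ANR_space :> topologicalType;
  ANR_axiom : is_metric_ANR ANR_space }.

(* A shape morphism X -> Y is a natural transformation [Y, -] -> [X, -] of
   functors on the homotopy category of metric ANRs. *)
Record shape_morphism (X Y : topologicalType) := ShapeMorphism {
  shape_app :> forall P : metric_ANR, htpy_class Y P -> htpy_class X P;
  shape_natural : forall (P Q : metric_ANR) (a : htpy_class P Q)
    (b : htpy_class Y P), shape_app (hcomp a b) = hcomp a (shape_app b) }.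

Definition shape_id (X : topologicalType) : shape_morphism X X :=
  @ShapeMorphism X X (fun P b => b) (fun P Q a b => erefl).

Lemma shape_comp_subproof (X Y W : topologicalType) (psi : shape_morphism Y W)
    (phi : shape_morphism X Y) (P Q : metric_ANR) (a : htpy_class P Q)
    (b : htpy_class W P) :
  phi Q (psi Q (hcomp a b)) = hcomp a (phi P (psi P b)).
Proof. by rewrite !shape_natural. Qed.

Definition shape_comp (X Y W : topologicalType) (psi : shape_morphism Y W)
    (phi : shape_morphism X Y) : shape_morphism X W :=
  @ShapeMorphism X W (fun P b => phi P (psi P b)) (shape_comp_subproof psi phi).

Definition same_shape (X Y : topologicalType) : Prop :=
  exists (phi : shape_morphism X Y) (psi : shape_morphism Y X),
    shape_comp psi phi = shape_id X /\ shape_comp phi psi = shape_id Y.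

End Homotopy.

(* Main.v *)
Require Import Defs.
From HB Require Import structures.
From mathcomp Require Import all_boot all_order all_algebra finmap.
From mathcomp Require Import all_classical reals topology normedtype.

Local Open Scope classical_set_scope.

(** Each finite family F of open sets has a finite space of traces
    {U in F | x in U}, for x in X, in which open means closed under supersets
    of traces; larger families restrict to smaller ones.  A point p of the
    limit L is a finitely consistent family of open sets of X, and compactness
    gives it a limit point r p, all of whose open neighborhoods belong to p.
    The map r is a continuous retraction of L onto the copy i X of X formed by
    the traces of points, and i (r p) lies in the closure of {p}.  Hence a
    continuous map h from L to a Hausdorff space satisfies h = h i r, so [i]
    and [r] induce inverse bijections between [L, P] and [X, P]. *)

Set Implicit Arguments.
Unset Strict Implicit.
Unset Printing Implicit Defensive.

Import Order.TTheory.

(** * Convergence in inverse limits and maps into Hausdorff spaces *)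

Lemma cvg_initial (S : choiceType) (T : topologicalType) (f : S -> T)
    (F : set_system S) (s : S) :
  Filter F -> f @ F --> f s -> F --> (s : initial_topology f).
Proof.
move=> FF fFs A; rewrite nbhsE => -[B [[C oC <-] Cs] BA].
by apply: filterS BA _; apply: fFs; exact: open_nbhs_nbhs.
Qed.

Lemma cvg_prod_topology (I : Type) (T : I -> topologicalType)
    (F : set_system (prod_topology T)) (x : prod_topology T) :
  Filter F -> (forall i, (fun y => y i) @ F --> x i) -> F --> x.
Proof. by move=> FF Fx; apply/cvg_sup => i; exact: cvg_initial. Qed.

Lemma cvg_inverse_limit (d : Order.disp_t) (I : preorderType d)
    (S : inverse_system I) (F : set_system (inverse_limit S))
    (q : inverse_limit S) :
  Filter F -> (forall i, (fun p => set_val p i) @ F --> set_val q i) -> F --> q.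
Proof.
move=> FF Fq; apply: (@cvg_initial _ _ set_val) => //.
exact: cvg_prod_topology.
Qed.

Lemma continuous_inverse_limit (d : Order.disp_t) (I : preorderType d)
    (S : inverse_system I) (X : topologicalType) (f : X -> inverse_limit S) :
  (forall i, continuous (fun x => set_val (f x) i)) -> continuous f.
Proof. by move=> cf x; apply: cvg_inverse_limit => i; exact: cf. Qed.

Lemma continuous_inverse_limit_proj (d : Order.disp_t) (I : preorderType d)
    (S : inverse_system I) (i : I) :
  continuous (fun p : inverse_limit S => set_val p i).
Proof.
apply: (@continuousC _ _ _ (set_val : inverse_limit S -> _) (fun x => x i)).
  exact: continuous_set_val.
exact: proj_continuous.
Qed.

(* The hypothesis says that [y] lies in the closure of [[set x]]. *)
Lemma continuous_hausdorff_specialization (X P : topologicalType) (h : X -> P)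
    (x y : X) : hausdorff_space P -> continuous h ->
  (forall A, nbhs y A -> A x) -> h x = h y.
Proof.
move=> hP ch xy; apply: hP => A B hxA hyB; exists (h x); split.
  exact: nbhs_singleton.
by apply: (xy (h @^-1` B)); exact: ch.
Qed.

Lemma homeomorphic_hausdorff (X Y : topologicalType) :
  homeomorphic X Y -> hausdorff_space Y -> hausdorff_space X.
Proof.
move=> [f [g [fK gK cf cg]]] hY x y xy; apply: (can_inj fK); apply: hY => A B.
move=> /cf fA /cf fB; have [z [Az Bz]] := xy _ _ fA fB.
by exists (f z).
Qed.

(** * Shape morphisms induced by continuous maps *)

Section HomotopyClasses.
Context (R : realType).

Lemma hcompA (X Y Z W : topologicalType) (a : htpy_class R Z W)
    (b : htpy_class R Y Z) (c : htpy_class R X Y) :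
  hcomp a (hcomp b c) = hcomp (hcomp a b) c.
Proof.
rewrite -(hreprK a) -(hreprK b) -(hreprK c) !hcompE.
by congr hclass; exact/continuousEP.
Qed.

Definition shape_of_map (X Y : topologicalType) (f : continuousType X Y) :
  shape_morphism R X Y :=
  @ShapeMorphism R X Y (fun P b => hcomp b (hclass R f))
    (fun P Q a b => esym (hcompA a b (hclass R f))).

Lemma shape_morphism_eq (X Y : topologicalType) (phi psi : shape_morphism R X Y) :
  (forall P b, phi P b = psi P b) -> phi = psi.
Proof.
case: phi psi => [f fn] [g gn] /= fg.
have {}fg : f = g by apply: functional_extensionality_dep => P; exact/funext/fg.
by rewrite -fg in gn *; congr ShapeMorphism; exact: Prop_irrelevance.
Qed.

(** Precomposition with [i] and with [r] gives mutually inverse shape morphisms: [i \o r] acts as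
    the identity on maps into each metric ANR, even before passing to homotopy classes. *)
Lemma same_shape_of_maps (L X : topologicalType) (i : X -> L) (r : L -> X) :
  continuous i -> continuous r -> cancel i r ->
  (forall (P : metric_ANR R) (h : L -> P), continuous h -> h \o i \o r = h) ->
  same_shape R L X.
Proof.
move=> ci cr iK hir.
pose ic : continuousType X L := HB.pack_for (continuousType X L) i
  (isContinuous.Build X L i ci).
pose rc : continuousType L X := HB.pack_for (continuousType L X) r
  (isContinuous.Build L X r cr).
exists (shape_of_map rc), (shape_of_map ic); split.
  apply: shape_morphism_eq => P b /=; rewrite -(hreprK b) !hcompE.
  congr hclass; apply/continuousEP => p.
  by have /(congr1 (fun h => h p)) := hir P _ (@cts_fun _ _ (hrepr b)).
apply: shape_morphism_eq => P b /=; rewrite -(hreprK b) !hcompE.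
by congr hclass; apply/continuousEP => x /=; rewrite iK.
Qed.

End HomotopyClasses.

(** * Finite trace spaces and their inverse system *)

Section Traces.
Context (X : topologicalType).

(** Openness is tested inside the trace, so that the index families may be arbitrary finite sets of
    subsets. *)
Definition trace (F : set (set X)) (x : X) : set (set X) :=
  [set U | [/\ F U, open U & U x]].

Lemma finite_traces (F : set (set X)) : finite_set F ->
  finite_set (range (trace F)).
Proof.
move=> finF; pose G := fset_set F.
apply: (sub_finite_set _ (finite_image (fun B : {fset set X} => [set` B])
  (finite_fset (fpowerset G)))) => _ [x _ <-].
have tF : trace F x `<=` F by move=> U [].
have finT := sub_finite_set tF finF.
exists (fset_set (trace F x)); last exact: fset_setK.
by rewrite /= fpowersetE -fset_set_sub.
Qed.

Definition trace_space (F : set (set X)) : Type := set_type (range (trace F)).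

Section TraceSpace.
Context (F : set (set X)).

HB.instance Definition _ := Choice.on (trace_space F).

(** The Alexandrov topology of the inclusion order on traces. *)
Let upset : set_system (trace_space F) :=
  [set A | forall s t : trace_space F,
    set_val s `<=` set_val t -> A s -> A t].

Let upsetT : upset setT. Proof. by []. Qed.

Let upsetI : setI_closed upset.
Proof.
by move=> A B uA uB s t st [As Bs]; split; [exact: uA As|exact: uB Bs].
Qed.

Let upset_bigcup (I : Type) (f : I -> set (trace_space F)) :
  (forall i, upset (f i)) -> upset (\bigcup_i f i).
Proof. by move=> uf s t st [i _ fs]; exists i => //; exact: uf fs. Qed.

HB.instance Definition _ :=
  isOpenTopological.Build (trace_space F) upsetT upsetI upset_bigcup.

Lemma open_trace_spaceE (A : set (trace_space F)) : open A =
  (forall s t : trace_space F, set_val s `<=` set_val t -> A s -> A t).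
Proof. by []. Qed.

Definition to_trace (x : X) : trace_space F :=
  SigSub (mem_set (imageT (trace F) x)).

Lemma to_trace_surj (s : trace_space F) : exists x, s = to_trace x.
Proof. by have [x _ xs] := set_valP s; exists x; exact: val_inj. Qed.

(** The finitely many members of the trace of [x] intersect in a neighborhood of [x], and each point
    of it has at least the trace of [x]. *)
Lemma continuous_to_trace : finite_set F -> continuous to_trace.
Proof.
move=> finF; apply/continuousP => A oA; rewrite openE => x Ax.
have finT : finite_set (trace F x) by apply: sub_finite_set finF => U [].
have : nbhs x (\bigcap_(U in trace F x) U).
  rewrite -(fset_setK finT); apply: filter_bigI => U.
  rewrite in_fset_set // inE => -[_ oU Ux].
  exact: open_nbhs_nbhs.
apply: filterS => y xy; apply: (oA (to_trace x)) => // U /[dup] [[FU oU _]] tU.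
by split=> //; exact: xy.
Qed.

End TraceSpace.

Lemma restrict_trace_subproof (F G : set (set X)) (s : trace_space G) :
  F `<=` G -> set_val s `&` F \in range (trace F).
Proof.
move=> FG; have [x ->] := to_trace_surj s; apply/mem_set; exists x => //.
by apply/seteqP; split=> U; [case=> FU oU Ux; split=> //; split=> //; exact: FG
                            |case=> -[_ oU Ux] FU].
Qed.

Definition restrict_trace (F G : set (set X)) (FG : F `<=` G)
    (s : trace_space G) : trace_space F :=
  SigSub (restrict_trace_subproof s FG).

Lemma continuous_restrict_trace (F G : set (set X)) (FG : F `<=` G) :
  continuous (restrict_trace FG).
Proof.
apply/continuousP => A; rewrite !open_trace_spaceE => oA s t st.
by apply: oA; exact: setSI.
Qed.

Definition finite_family := set_type [set F : set (set X) | finite_set F].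

HB.instance Definition _ := Choice.on finite_family.
HB.instance Definition _ := SubType.on finite_family.
HB.instance Definition _ := 
  [SubChoice_isSubPOrder of finite_family by <: with set_display].

Lemma le_finite_family (F G : finite_family) : (F <= G)%O -> val F `<=` val G.
Proof. by rewrite leEsub => /subsetPset. Qed.

Lemma finite_family_finite (F : finite_family) : finite_set (val F).
Proof. exact: set_mem (valP F). Qed.

Definition mk_family (F : set (set X)) (finF : finite_set F) : finite_family :=
  SigSub (mem_set (finF : [set F : set (set X) | finite_set F] F)).

Lemma directed_finite_family : directed finite_family.
Proof.
split; first by exists (mk_family (finite_set0 _)).
move=> F G; have finU : finite_set (val F `|` val G).
  by rewrite finite_setU; split; exact: finite_family_finite.
exists (mk_family finU).
by rewrite !leEsub; split; apply/subsetPset; [exact: subsetUl|exact: subsetUr].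
Qed.

Lemma restrict_trace_id (F : finite_family) (FF : (F <= F)%O)
  (s : trace_space (val F)) : restrict_trace (le_finite_family FF) s = s.
Proof.
apply: val_inj; have [x ->] := to_trace_surj s; apply/setIidPl => U [] //.
Qed.

Lemma restrict_trace_comp (F G H : finite_family) (FG : (F <= G)%O)
    (GH : (G <= H)%O) (FH : (F <= H)%O) (s : trace_space (val H)) :
  restrict_trace (le_finite_family FG)
    (restrict_trace (le_finite_family GH) s) =
  restrict_trace (le_finite_family FH) s.
Proof.
apply: val_inj; rewrite /= -setIA; congr (_ `&` _).
exact/setIidPr/le_finite_family.
Qed.

Definition trace_system : inverse_system finite_family :=
  @InverseSystem _ finite_family (fun F => trace_space (val F))
    (fun F G FG => restrict_trace (le_finite_family FG))
    (fun F G FG => @continuous_restrict_trace _ _ (le_finite_family FG))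
    restrict_trace_id restrict_trace_comp.

(** * Points of the limit as finitely consistent families of open sets *)

Local Notation L := (inverse_limit trace_system).

Lemma to_limit_subproof (x : X) :
  (fun F : finite_family => to_trace (val F) x) \in limit_set trace_system.
Proof.
apply/mem_set => F G FG; apply: val_inj; apply/seteqP.
by split=> U; [case=> -[_ oU Ux] FU|case=> FU oU Ux; do 2!split=> //;
  exact: le_finite_family FG _ FU].
Qed.

Definition to_limit (x : X) : L := SigSub (to_limit_subproof x).

Lemma continuous_to_limit : continuous to_limit.
Proof.
apply: continuous_inverse_limit => F.
exact/continuous_to_trace/finite_family_finite.
Qed.

(** Membership is read off at the smallest index that sees [U]; by [in_limitE] every larger index
    gives the same answer. *)
Definition in_limit (p : L) (U : set X) : Prop :=
  set_val (set_val p (mk_family (finite_set1 U))) U.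

Lemma in_limitE (p : L) (F : finite_family) (U : set X) : val F U ->
  in_limit p U = set_val (set_val p F) U.
Proof.
move=> FU.
have UF : (mk_family (finite_set1 U) <= F)%O.
  by rewrite leEsub; apply/subsetPset => V ->.
rewrite /in_limit; have <- : bond trace_system UF (set_val p F) = set_val p _ :=
  set_valP p _ _ UF.
apply/propext.
by split=> [[]//|sU]; split.
Qed.

(** Finite consistency: each coordinate of [p] is the trace of an actual point of [X]. *)
Lemma in_limit_finite (p : L) (F : finite_family) :
  exists x, forall U, val F U -> open U -> in_limit p U <-> U x.
Proof.
have [x px] := to_trace_surj (set_val p F); exists x => U FU oU.
by rewrite (in_limitE p FU) px; split=> [[]|].
Qed.

Lemma open_in_limit (U : set X) : open [set p : L | in_limit p U].
Proof.
pose F := mk_family (finite_set1 U).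
rewrite (_ : mkset _ = (fun p : L => set_val p F) @^-1` [set s | set_val s U])//.
apply: (proj1 (continuousP _) (@continuous_inverse_limit_proj _ _ _ F)).
by move=> s t st; exact: st.
Qed.

(** The sets [B F] of points that realize [p] on [F] form a filter base, so by compactness they have
    a cluster point [x]. An open [U] around [x] meets [B F] for the family [F] whose only member is
    [U], which forces [U] into [p]. *)
Lemma exists_limit_point (p : L) : compact [set: X] ->
  exists x, forall U, open U -> U x -> in_limit p U.
Proof.
move=> cX.
pose B (F : finite_family) : set X :=
  [set x | forall U, val F U -> open U -> in_limit p U <-> U x].
have [[F0 _] dir] := directed_finite_family.
have FF : ProperFilter (filter_from setT B).
  apply: filter_from_proper => [|F _]; last exact: in_limit_finite.
  apply: filter_from_filter; first by exists F0.
  move=> F G _ _; have [H [FH GH]] := dir F G; exists H => // x Hx.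
  by split=> U FU; apply: Hx; [exact: le_finite_family FH _ FU
                              |exact: le_finite_family GH _ FU].
have [|x [_ clx]] := cX _ FF; first by exists F0.
exists x => U oU Ux; pose F := mk_family (finite_set1 U).
have [||y [By Uy]] := clx (B F) U; first by exists F.
  exact: open_nbhs_nbhs.
exact/(By U).
Qed.

(** * The retraction of the limit onto the compact Hausdorff space *)

Section Retraction.
Context (cX : compact [set: X]) (hX : hausdorff_space X).

Definition limit_point (p : L) : X := projT1 (cid (exists_limit_point p cX)).

Lemma limit_pointP (p : L) (U : set X) : open U -> U (limit_point p) ->
  in_limit p U.
Proof. by move=> oU; exact: (projT2 (cid (exists_limit_point p cX))). Qed.

Lemma continuous_limit_point : continuous limit_point.
Proof.
move=> p A rA; have [C] := compact_regular hX cX filterT rA.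
rewrite nbhsE => -[W [oW Wr] WC] CA.
have : nbhs p [set q | in_limit q W].
  by apply: open_nbhs_nbhs; split; [exact: open_in_limit|exact: limit_pointP].
apply: filterS => q qW; apply: CA; apply: (closure_subset WC).
(* Otherwise [q] contains both [W] and the complement of its closure. These are disjoint, yet finite
   consistency yields a point lying in both. *)
apply: contrapT => rW.
have oV : open (~` closure W) by exact/closed_openC/closed_closure.
have qV := limit_pointP oV rW.
have [x xP] := in_limit_finite q (mk_family (finite_set2 W (~` closure W))).
have /(xP _ (or_introl erefl) oW) Wx := qW.
by move/(xP _ (or_intror erefl) oV): qV; apply; exact: subset_closure.
Qed.

(** Every open neighborhood of the limit point of [to_limit x] contains [x], so the two points
    cannot be separated. *)
Lemma to_limitK : cancel to_limit limit_point.
Proof.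
move=> x; apply: hX => A B; rewrite !nbhsE => -[U [oU Ur] UA] [V [oV Vx] VB].
have [_ _ Ux] : in_limit (to_limit x) U by exact: limit_pointP.
by exists x; split; [exact: UA|exact: VB].
Qed.

(** At each index [F], the trace of [limit_point p] is included in the coordinate of [p], so an open
    set of traces containing the former contains the latter. *)
Lemma limit_point_specialization (p : L) (A : set L) :
  nbhs (to_limit (limit_point p)) A -> A p.
Proof.
(* Convergence of the principal filter at [p] says that [p] lies in every neighborhood of the
   target, and it can be checked coordinatewise. *)
have : (globally [set p]) --> to_limit (limit_point p).
  apply: cvg_inverse_limit => F B; rewrite nbhsE => -[O [oO Or] OB] _ ->.
  apply/OB/(oO _ _ _ Or) => U [FU oU Ur].
  by rewrite -(in_limitE p FU); exact: limit_pointP.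
by move=> /(_ A) pA /pA; exact.
Qed.

End Retraction.
End Traces.

Theorem corollary1 (R : realType) (X : topologicalType)
  (compactX : compact [set: X]) (hausdorffX : hausdorff_space X) :
  exists (d : Order.disp_t) (I : preorderType d) (S : inverse_system I),
    [/\ directed I, forall i : I, finite_set [set: S i]
      & same_shape R (inverse_limit S) X].
Proof.
exists _, (finite_family X), (trace_system X); split.
- exact: directed_finite_family.
- move=> F; rewrite (eq_finite_set (card_setT _)).
  exact/finite_traces/finite_family_finite.
- apply: (@same_shape_of_maps R _ _ _ _ (@continuous_to_limit X)
    (@continuous_limit_point X compactX hausdorffX)
    (@to_limitK X compactX hausdorffX)) => P h ch.
  (* Metrizability makes [P] Hausdorff, so [h] cannot distinguish [p] from a point in its
     closure. *)
  have [[M PM] _] := ANR_axiom P.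
  have hP := homeomorphic_hausdorff PM (@metric_hausdorff _ M).
  apply/funext => p; apply/esym.
  apply: continuous_hausdorff_specialization => // A.
  exact: limit_point_specialization.
Qed.
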